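(* Let $n\ge 1$ be an integer, and let $V$ be a fixed optimal oracle prefix-free Turing machine whose outputs are rational points in $\mathbb Q^n$, with associated point complexity $K^A_r(x)$. For every nonempty $E\subseteq\mathbb R^n$, \[ \dim_H(E)=\min_{A\subseteq\omega}\ \sup_{x\in E}\ \liminf_{r\to\infty}\frac{K^A_r(x)}{r}, \qquad \dim_P(E)=\min_{A\subseteq\omega}\ \sup_{x\in E}\ \limsup_{r\to\infty}\frac{K^A_r(x)}{r}, \] with both minima attained.
   Context: $\omega=\{0,1,2,\dots\}$; $2^{<\omega}$ is the set of finite binary strings, $|p|$ the length of $p$. A set of strings is prefix-free if no element is a proper prefix of another. An oracle prefix-free Turing machine $M$ is an oracle Turing machine with inputs in $2^{<\omega}$ such that for every oracle $A\subseteq\omega$ the domain of the partial function $M^A$ is prefix-free. $V$ (with outputs in $\mathbb Q^n$, coded in a standard computable way) is optimal if for every oracle prefix-free Turing machine $M$ with outputs in $\mathbb Q^n$ there is a constant $c_M$ such that for every oracle $A$ and every $q\in\mathbb Q^n$, $\min\{|p|:V^A(p)=q\}\le\min\{|p|:M^A(p)=q\}+c_M$ (minimum over the empty set is $\infty$). For an oracle $A\subseteq\omega$ and $q\in\mathbb Q^n$ put $K^A(q)=\min\{|p|:V^A(p)=q\}$, and for $x\in\mathbb R^n$, $r\in\omega$ put \[ K^A_r(x)=\min\{K^A(q):q\in\mathbb Q^n,\ |x-q|<2^{-r}\}, \] where $|\cdot|$ on $\mathbb R^n$ is the Euclidean norm. Hausdorff dimension: $\mathcal H^s_\delta(E)$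 is the infimum of $\sum_i(\operatorname{diam}U_i)^s$ over finite or countable covers $(U_i)$ of $E$ with $0<\operatorname{diam}U_i\le\delta$; $\mathcal H^s(E)=\lim_{\delta\to0}\mathcal H^s_\delta(E)$; $\dim_H(E)=\inf\{s\ge0:\mathcal H^s(E)=0\}$. Packing dimension: a $\delta$-packing of $E$ is a finite or countable, possibly empty, family of pairwise disjoint closed balls of positive radius at most $\delta$ with centers in $E$; $\mathcal P^s_\delta(E)$ is the supremum of $\sum_i(\operatorname{diam}B_i)^s$ over $\delta$-packings $(B_i)$ of $E$; $\mathcal P^s_0(E)=\lim_{\delta\to0}\mathcal P^s_\delta(E)$; $\mathcal P^s(E)=\inf\{\sum_{j\ge1}\mathcal P^s_0(E_j):E\subseteq\bigcup_{j\ge1}E_j\}$; $\dim_P(E)=\inf\{s\ge0:\mathcal P^s(E)=0\}$. *)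

(* Defs.v *)
From HB Require Import structures.
From mathcomp Require Import all_boot all_order all_algebra.
From mathcomp Require Import all_classical all_reals all_analysis.

Set Implicit Arguments.
Unset Strict Implicit.
Unset Printing Implicit Defensive.

Import Order.TTheory GRing.Theory Num.Theory.
Import numFieldNormedType.Exports.

Local Open Scope classical_set_scope.
Local Open Scope ring_scope.

Inductive move := MoveLeft | Stay | MoveRight.

(* All tapes are one-way infinite, with cells indexed by nat; moving left from
   cell 0 has no effect. *)
Definition move_head (m : move) (h : nat) : nat :=
  match m with MoveLeft => h.-1 | Stay => h | MoveRight => h.+1 end.

(* A machine has
   - a read-only input tape holding the input string, on which it reads [None]
     beyond the end of the input;
   - a read-only oracle tape holding the characteristic function of the oracle:
     cell k tells whether k belongs to the oracle;
   - finitely many work tapes, initially blank;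
   - a write-only output tape, to which each step may append one bit.
   [tm_next q a b w] is what is done in the non-final state [q] on reading [a] on
   the input tape, [b] on the oracle tape and [w i] on the i-th work tape. *)
Record action (state symbol : finType) (k : nat) := Action {
  act_state : state;
  act_input : move;
  act_oracle : move;
  act_work : {ffun 'I_k -> symbol * move};
  act_output : option bool
}.

Record oracle_machine := OracleMachine {
  tm_state : finType;
  tm_symbol : finType;
  tm_tapes : nat;
  tm_blank : tm_symbol;
  tm_start : tm_state;
  tm_final : pred tm_state;
  tm_next : tm_state -> option bool -> bool -> {ffun 'I_tm_tapes -> tm_symbol} ->
            action tm_state tm_symbol tm_tapes
}.

Record config (M : oracle_machine) := Config {
  cf_state : tm_state M;
  cf_input : nat;
  cf_oracle : nat;
  cf_work : 'I_(tm_tapes M) -> (nat -> tm_symbol M) * nat;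
  cf_output : seq bool
}.

Definition init_config (M : oracle_machine) : config M :=
  Config (tm_start M) 0 0 (fun=> (fun=> tm_blank M, 0%N)) [::].

Definition update_tape (T : Type) (t : (nat -> T) * nat) (a : T * move) :
    (nat -> T) * nat :=
  (fun j => if j == t.2 then a.1 else t.1 j, move_head a.2 t.2).

Definition step (M : oracle_machine) (A : set nat) (p : seq bool)
    (c : config M) : config M :=
  if tm_final (cf_state c) then c else
  let a := tm_next (cf_state c) (onth p (cf_input c)) (cf_oracle c \in A)
             [ffun i => (cf_work c i).1 (cf_work c i).2] in
  Config (act_state a)
         (move_head (act_input a) (cf_input c))
         (move_head (act_oracle a) (cf_oracle c))
         (fun i => update_tape (cf_work c i) (act_work a i))
         (if act_output a is Some b then rcons (cf_output c) b else cf_output c).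

Definition halts_with (M : oracle_machine) (A : set nat) (p w : seq bool) : Prop :=
  exists t : nat, let c := iter t (step A p) (init_config M) in
    tm_final (cf_state c) /\ cf_output c = w.

Definition prefix_free (D : set (seq bool)) : Prop :=
  forall p q, D p -> D q -> prefix p q -> p = q.

Definition prefix_free_machine (M : oracle_machine) : Prop :=
  forall A : set nat, prefix_free [set p | exists w, halts_with M A p w].

(* Lengths of the runs of [true] delimited by the occurrences of [false]:
   [blocks (1^a0 0 1^a1 0 .. 0 1^am)] is [:: a0; a1; ..; am]. *)
Definition blocks (w : seq bool) : seq nat :=
  foldr (fun b s => if b then (head 0%N s).+1 :: behead s else 0%N :: s)
    [:: 0%N] w.

(* Every string names a rational point, and every rational point has a name: the
   i-th coordinate is (a - b) / (c + 1), where a, b, c are the blocks of index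
   3i, 3i + 1, 3i + 2, and missing blocks are read as 0. *)
Definition decode_point (n : nat) (w : seq bool) : 'rV[rat]_n :=
  let a := nth 0%N (blocks w) in
  \row_(i < n) (((a (3 * i)%N)%:R - (a (3 * i + 1)%N)%:R) / (a (3 * i + 2)%N).+1%:R).

Definition outputs (n : nat) (M : oracle_machine) (A : set nat) (p : seq bool)
    (q : 'rV[rat]_n) : Prop :=
  exists2 w, halts_with M A p w & decode_point n w = q.

(* The infimum is attained, or is +oo when [M] has no program for [q]. *)
Definition complexity (R : realType) (n : nat) (M : oracle_machine) (A : set nat)
    (q : 'rV[rat]_n) : \bar R :=
  ereal_inf [set ((size p)%:R%:E : \bar R) | p in [set p | outputs M A p q]].

Definition optimal (R : realType) (n : nat) (V : oracle_machine) : Prop :=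
  prefix_free_machine V /\
  forall M : oracle_machine, prefix_free_machine M ->
    exists c : nat, forall (A : set nat) (q : 'rV[rat]_n),
      (complexity R V A q <= complexity R M A q + c%:R%:E)%E.

(* The library norm on 'rV[R]_n is the sup norm. *)
Definition enorm (R : realType) (n : nat) (x : 'rV[R]_n) : R :=
  Num.sqrt (\sum_(i < n) x ord0 i ^+ 2).

Definition point_complexity (R : realType) (n : nat) (V : oracle_machine)
    (A : set nat) (r : nat) (x : 'rV[R]_n) : \bar R :=
  ereal_inf [set complexity R V A q
            | q in [set q : 'rV[rat]_n | enorm (x - map_mx ratr q) < 2 ^- r]].

Definition lower_complexity_density (R : realType) (n : nat) (V : oracle_machine)
    (A : set nat) (x : 'rV[R]_n) : \bar R :=
  limn_einf (fun r : nat => point_complexity V A r x / r%:R%:E)%E.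

Definition upper_complexity_density (R : realType) (n : nat) (V : oracle_machine)
    (A : set nat) (x : 'rV[R]_n) : \bar R :=
  limn_esup (fun r : nat => point_complexity V A r x / r%:R%:E)%E.

Definition diam (R : realType) (n : nat) (U : set 'rV[R]_n) : \bar R :=
  ereal_sup [set (enorm (z.1 - z.2))%:E | z in U `*` U].

(* In what follows, finite or countable families are indexed by an arbitrary
   set of natural numbers. *)
Definition is_cover (R : realType) (n : nat) (delta : R) (E : set 'rV[R]_n)
    (I : set nat) (U : nat -> set 'rV[R]_n) : Prop :=
  E `<=` \bigcup_(i in I) U i /\
  forall i, I i -> (0 < diam (U i) <= delta%:E)%E.

Definition hausdorff_content (R : realType) (n : nat) (s delta : R)
    (E : set 'rV[R]_n) : \bar R :=
  ereal_inf [set h | exists (I : set nat) (U : nat -> set 'rV[R]_n),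
    is_cover delta E I U /\ h = \esum_(i in I) poweR (diam (U i)) s].

Definition hausdorff_measure (R : realType) (n : nat) (s : R)
    (E : set 'rV[R]_n) : \bar R :=
  lim (hausdorff_content s delta E @[delta --> 0^'+]).

Definition hausdorff_dim (R : realType) (n : nat) (E : set 'rV[R]_n) : \bar R :=
  ereal_inf [set s%:E | s in [set s : R | 0 <= s /\ hausdorff_measure s E = 0%E]].

Definition closed_eball (R : realType) (n : nat) (c : 'rV[R]_n) (rho : R) :
    set 'rV[R]_n :=
  [set x | enorm (x - c) <= rho].

Definition is_packing (R : realType) (n : nat) (delta : R) (E : set 'rV[R]_n)
    (I : set nat) (c : nat -> 'rV[R]_n) (rho : nat -> R) : Prop :=
  (forall i, I i -> E (c i) /\ 0 < rho i <= delta) /\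
  trivIset I (fun i => closed_eball (c i) (rho i)).

Definition packing_content (R : realType) (n : nat) (s delta : R)
    (E : set 'rV[R]_n) : \bar R :=
  ereal_sup [set h | exists (I : set nat) (c : nat -> 'rV[R]_n) (rho : nat -> R),
    is_packing delta E I c rho /\
    h = \esum_(i in I) poweR (diam (closed_eball (c i) (rho i))) s].

Definition packing_premeasure (R : realType) (n : nat) (s : R)
    (E : set 'rV[R]_n) : \bar R :=
  lim (packing_content s delta E @[delta --> 0^'+]).

Definition packing_measure (R : realType) (n : nat) (s : R)
    (E : set 'rV[R]_n) : \bar R :=
  ereal_inf [set (\sum_(j <oo) packing_premeasure s (F j))%E
            | F in [set F : nat -> set 'rV[R]_n | E `<=` \bigcup_j F j]].

Definition packing_dim (R : realType) (n : nat) (E : set 'rV[R]_n) : \bar R :=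
  ereal_inf [set s%:E | s in [set s : R | 0 <= s /\ packing_measure s E = 0%E]].

Definition is_minimum (R : realType) (S : set (\bar R)) (m : \bar R) : Prop :=
  S m /\ lbound S m.

(* Main.v *)
Require Import Defs.
From HB Require Import structures.
From mathcomp Require Import all_boot all_order all_algebra.
From mathcomp Require Import all_classical all_reals all_analysis.
From mathcomp Require Import zify ring lra.

(** Lower bounds: at precision [2 ^- r] at most [2 ^ (s r + 1)] rational points have
    complexity at most [s r].  If the density stays below [s] on [E], the balls of
    radius [2 ^- r] around these points give covers of [E], respectively control the
    disjoint balls of a packing centred in [E], with sums dominated by a geometric
    series of ratio [2 ^ (s - s')] for every [s' > s].

    Attainment: take exponents decreasing to the dimension and, for each of them,
    covers of small sum (for packing: a decomposition of [E] into pieces of small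
    packing content, and maximal separated subsets of the pieces at each scale).  At
    level [r] these involve about [2 ^ (s r)] balls, so a ball is named by [s r] bits
    plus [o(r)] bits for the indices.  An oracle listing all the pairs (name, centre)
    makes a fixed machine print the centre on input the name, and optimality of [V]
    transfers the bound to [V]. *)

Set Implicit Arguments.
Unset Strict Implicit.
Unset Printing Implicit Defensive.

Import Order.TTheory GRing.Theory Num.Theory.
Import numFieldNormedType.Exports.

Local Open Scope classical_set_scope.
Local Open Scope ring_scope.

(** * A machine interpreting its oracle *)

Inductive mode := Live | Dead | Out | Halt | Stuck.

Definition mode_code (m : mode) : 'I_5 :=
  match m with
  | Live => inord 0 | Dead => inord 1 | Out => inord 2
  | Halt => inord 3 | Stuck => inord 4
  end.

Definition mode_decode (i : 'I_5) : mode := nth Stuck [:: Live; Dead; Out; Halt] i.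

Lemma mode_codeK : cancel mode_code mode_decode.
Proof. by case; rewrite /mode_decode /= inordK. Qed.

HB.instance Definition _ := Finite.copy mode (can_type mode_codeK).

(* The oracle is read from left to right as a sequence of two-bit commands, the
   second component of a state holding the first bit of the current command:
   - [0b], test the next input bit against [b] ([Live]), or print [b] ([Out]);
   - [10], require the end of the input and start printing ([Live]), move the input
     head to the left ([Dead]), or halt ([Out]);
   - [11], resume testing ([Dead]).
   A failed bit test leads from [Live] to [Dead]; a test failing because of the
   length of the input leads to [Stuck], which is never left. *)
Definition interp_next (q : mode * option bool) (a : option bool) (b : bool)
    (w : {ffun 'I_0 -> unit}) : action (mode * option bool)%type unit 0 :=
  let act m i o := @Action (mode * option bool)%type unit 0
    (m, None) i MoveRight [ffun=> (tt, Stay)] o in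
  let: (m, c) := q in
  if c is Some c1 then
    match m, c1 with
    | Live, false =>
        match a with
        | Some x => if x == b then act Live MoveRight None else act Dead Stay None
        | None => act Stuck Stay None
        end
    | Live, true =>
        if b then act Live Stay None
        else if a is None then act Out Stay None else act Stuck Stay None
    | Dead, false => act Dead Stay None
    | Dead, true => if b then act Live Stay None else act Dead MoveLeft None
    | Out, false => act Out Stay (Some b)
    | Out, true => act Halt Stay None
    | _, _ => act m Stay None
    end
  else @Action (mode * option bool)%type unit 0
         (m, Some b) Stay MoveRight [ffun=> (tt, Stay)] None.

Definition interp_machine : oracle_machine :=
  @OracleMachine (mode * option bool)%type unit 0 tt (Live, None)
    (fun q => q.1 == Halt) interp_next.

Definition command := (bool * bool)%type.

Definition interp_state := (mode * nat * seq bool)%type.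

Definition exec (p : seq bool) (s : interp_state) (c : command) : interp_state :=
  let: (m, h, o) := s in
  match m, c with
  | Live, (false, b) =>
      match onth p h with
      | Some x => if x == b then (Live, h.+1, o) else (Dead, h, o)
      | None => (Stuck, h, o)
      end
  | Live, (true, true) => (Live, h, o)
  | Live, (true, false) => if onth p h is None then (Out, h, o) else (Stuck, h, o)
  | Dead, (false, _) => (Dead, h, o)
  | Dead, (true, true) => (Live, h, o)
  | Dead, (true, false) => (Dead, h.-1, o)
  | Out, (false, b) => (Out, h, rcons o b)
  | Out, (true, _) => (Halt, h, o)
  | _, _ => s
  end.

Definition oracle_command (A : set nat) (k : nat) : command :=
  ((k.*2 \in A), (k.*2.+1 \in A)).

Definition run (p : seq bool) (f : nat -> command) (k : nat) : interp_state :=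
  foldl (exec p) (Live, 0%N, [::]) (mkseq f k).

Lemma runS p f k : run p f k.+1 = exec p (run p f k) (f k).
Proof. by rewrite /run /mkseq -addn1 iotaD map_cat foldl_cat. Qed.

(** A command takes two steps, one for each of its bits, whence [k.*2]. A halted configuration is
    frozen, so the oracle head is tracked only before halting. *)
Lemma iter_interp A p k :
  let c := iter k.*2 (step A p) (init_config interp_machine) in
  let: (m, h, o) := run p (oracle_command A) k in
  [/\ cf_state c = (m, None), cf_input c = h, cf_output c = o &
      m <> Halt -> cf_oracle c = k.*2].
Proof.
elim: k => [|k] //=.
rewrite runS; set c := iter _ _ _.
case: (run _ _ _) => [[m h] o] [cs ci co cor].
case: (altP (m =P Halt)) => [mH|/eqP mH].
  have e : step A p c = c by rewrite /step cs mH /= eqxx.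
  by rewrite !e cs mH; split=> //; rewrite -mH.
have cH : (m == Halt) = false by apply/eqP.
have {}cor := cor mH.
have [] : [/\ cf_state (step A p c) = (m, Some (k.*2 \in A)),
    cf_input (step A p c) = h, cf_output (step A p c) = o &
    cf_oracle (step A p c) = k.*2.+1].
  by rewrite /step cs /= cH /= ci co cor.
set c1 := step A p c => s1 i1 o1 r1.
rewrite /step s1 /= cH i1 o1 r1 /= /oracle_command.
clear -cH; case: m cH => //= _; case: (_ \in A) => /=; case: (_ \in A) => /=;
  by case: (onth p h) => [[]|].
Qed.

Lemma run_halt p f k l : (run p f k).1.1 = Halt -> (k <= l)%N ->
  run p f l = run p f k.
Proof.
move=> kH /subnKC <-; elim: (l - k)%N => [|d IH]; first by rewrite addn0.
by rewrite addnS runS IH; case: (run p f k) kH => [[m h] o] /= ->.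
Qed.

Lemma run_stuck p f k l : (run p f k).1.1 = Stuck -> (k <= l)%N ->
  run p f l = run p f k.
Proof.
move=> kH /subnKC <-; elim: (l - k)%N => [|d IH]; first by rewrite addn0.
by rewrite addnS runS IH; case: (run p f k) kH => [[m h] o] /= ->.
Qed.

Lemma iter_final (M : oracle_machine) A p t u (c : config M) :
  tm_final (cf_state (iter t (step A p) c)) -> (t <= u)%N ->
  iter u (step A p) c = iter t (step A p) c.
Proof.
move=> H /subnKC <-; rewrite addnC; elim: (u - t)%N => [|d IH] //.
by rewrite addSn iterS IH /step H.
Qed.

Lemma halts_with_inj (M : oracle_machine) A p w w' :
  halts_with M A p w -> halts_with M A p w' -> w = w'.
Proof.
move=> [t [tf <-]] [u [uf <-]].
by rewrite -(iter_final tf (leq_maxl t u)) -(iter_final uf (leq_maxr t u)).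
Qed.

Lemma interp_haltsP A p w :
  halts_with interp_machine A p w <->
  exists k h, run p (oracle_command A) k = (Halt, h, w).
Proof.
split=> [[t [tf tw]]|[k [h kw]]].
  have t2 : (t <= t.*2)%N by rewrite -addnn leq_addr.
  have := iter_interp A p t; rewrite /= (iter_final tf t2).
  case E: (run _ _ _) => [[m h] o] [cs _ co _]; exists t, h.
  by move: tf; rewrite E cs /= -tw co => /eqP ->.
exists k.*2; have := iter_interp A p k; rewrite kw => -[cs _ co _].
by rewrite /= cs co /= eqxx.
Qed.

Definition scanning (m : mode) : bool :=
  match m with Live | Dead => true | _ => false end.

(* Until the head first leaves [p], the runs on [p] and on a proper extension [q]
   coincide; at that moment one of the two gets stuck for ever, since [p] only
   survives an end-of-input test and [q] only a bit test. *)
Lemma interp_prefix_free : prefix_free_machine interp_machine.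
Proof.
move=> A p q [w /interp_haltsP[k [h kp]]] [w' /interp_haltsP[k' [h' kq]]] pq.
apply/eqP; apply: contraT => npq.
have [x [s qE]] : exists x s, q = p ++ x :: s.
  move: pq npq => /prefixP[[|x s] ->]; last by exists x, s.
  by rewrite cats0 eqxx.
move: (oracle_command A) kp kq => f kp kq.
have inv i : [\/ (run p f i).1.1 = Stuck, (run q f i).1.1 = Stuck |
   run p f i = run q f i /\ scanning (run p f i).1.1 /\
   ((run p f i).1.2 <= size p)%N].
  elim: i => [|i [IH|IH|]]; first by constructor 3.
  - by constructor 1; rewrite (run_stuck IH).
  - by constructor 2; rewrite (run_stuck IH).
  rewrite !runS => -[<-]; case: (run p f i) => [[m g] o] /= [mL gp].
  have [pg|pg] := ltnP g (size p).
    have onq : onth q g = onth p g by rewrite qE onth_cat pg.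
    have [y py] : exists y, onth p g = Some y.
      by have := onthTE p g; rewrite pg; case: (onth p g) => // y _; exists y.
    case: m mL => //= _; case: (f i) => [[] b] /=; rewrite ?onq ?py /=.
    + by case: b; [constructor 3|constructor 1].
    + by constructor 3; case: ifP => /= _; rewrite ?pg ?(ltnW pg).
    + by case: b; constructor 3 => //=; split=> //; split=> //; exact: leq_trans (leq_pred _) gp.
    + by constructor 3.
  have gE : g = size p by apply/eqP; rewrite eqn_leq gp.
  have onp : onth p g = None by apply: onth_default.
  have onq : onth q g = Some x by rewrite qE onth_cat gE ltnn subnn.
  case: m mL => //= _; case: (f i) => [[] b] /=; rewrite ?onq ?onp /=.
  + by case: b; [constructor 3|constructor 2].
  + by constructor 1.
  + by case: b; constructor 3 => //=; split=> //; split=> //; exact: leq_trans (leq_pred _) gp.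
  + by constructor 3.
have hp : (run p f (maxn k k')).1.1 = Halt.
  by rewrite (@run_halt p f k) ?leq_maxl ?kp.
have hq : (run q f (maxn k k')).1.1 = Halt.
  by rewrite (@run_halt q f k') ?leq_maxr ?kq.
by case: (inv (maxn k k')) => [|/[!hq]|[_ []]]; rewrite ?hp.
Qed.

(* Prints [w] on input [p]. On an input incomparable with [p] it fails one of the bit
   tests, and the trailing [10]s then bring the input head back to cell 0: there are
   enough of them, since moving left from cell 0 has no effect. *)
Definition record_commands (p w : seq bool) : seq command :=
  [seq (false, b) | b <- p] ++ (true, false) :: [seq (false, b) | b <- w] ++
  nseq (size p).+1 (true, false) ++ [:: (true, true)].

Lemma exec_tests p a s b o : p = a ++ s ++ b ->
  foldl (exec p) (Live, size a, o) [seq (false, x) | x <- s] =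
  (Live, (size a + size s)%N, o).
Proof.
elim: s a => [|x s IH] a pE /=; first by rewrite addn0.
rewrite {2}pE onth_cat ltnn subnn /= eqxx.
by have := IH (rcons a x); rewrite size_rcons addSnnS; apply; rewrite pE -cats1 -catA.
Qed.

Lemma exec_dead_skip p h o s :
  foldl (exec p) (Dead, h, o) [seq (false, x) | x <- s] = (Dead, h, o).
Proof. by elim: s. Qed.

Lemma exec_dead_left p h o n :
  foldl (exec p) (Dead, h, o) (nseq n (true, false)) = (Dead, (h - n)%N, o).
Proof. by elim: n h => [|n IH] h /=; rewrite ?subn0 // IH subnS -!subn1 subnAC. Qed.

Lemma exec_out p h o s :
  foldl (exec p) (Out, h, o) [seq (false, x) | x <- s] = (Out, h, o ++ s).
Proof. by elim: s o => [|x s IH] o /=; rewrite ?cats0 // IH cat_rcons. Qed.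

Lemma exec_halt p h o s : foldl (exec p) (Halt, h, o) s = (Halt, h, o).
Proof. by elim: s. Qed.

Lemma record_match p w :
  foldl (exec p) (Live, 0%N, [::]) (record_commands p w) = (Halt, size p, w).
Proof.
rewrite /record_commands foldl_cat (@exec_tests p [::] p [::]) ?cats0 //= onth_default //.
by rewrite foldl_cat exec_out /= exec_halt.
Qed.

Lemma mismatch (p q : seq bool) : ~~ prefix p q -> ~~ prefix q p ->
  exists a x s y t, [/\ p = a ++ x :: s, q = a ++ y :: t & x != y].
Proof.
elim: p q => [|x p IH] [|y q] //=.
case: (altP (x =P y)) => [<-|xy _ _]; last by exists [::], x, p, y, q.
move=> pq qp; have [|//|a [x' [s [y' [t [-> -> n]]]]]] := IH q.
- by [].

- by move: qp; rewrite eqxx.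
by exists (x :: a), x', s, y', t.
Qed.

Lemma record_mismatch p q w : ~~ prefix p q -> ~~ prefix q p ->
  foldl (exec q) (Live, 0%N, [::]) (record_commands p w) = (Live, 0%N, [::]).
Proof.
move=> pq qp; have [a [x [s [y [t [pE qE xy]]]]]] := mismatch pq qp.
have onq : onth q (size a) = Some y by rewrite qE onth_cat ltnn subnn.
rewrite /record_commands {1}pE map_cat -catA foldl_cat.
rewrite (@exec_tests q [::] a (y :: t)) //= add0n onq.
rewrite eq_sym (negbTE xy) foldl_cat exec_dead_skip /= foldl_cat exec_dead_skip.
rewrite /= foldl_cat exec_dead_left /=.
(* The failed test leaves the head at [size a]; the [[10]] after the tests and the [size p + 1]
   final ones move it left [size p + 2] times in all. *)
suff -> : ((size a).-1.-1 - size p = 0)%N by [].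
apply/eqP; rewrite subn_eq0 pE size_cat.
exact: leq_trans (leq_pred _) (leq_trans (leq_pred _) (leq_addr _ _)).
Qed.

(** When all [l i] are nonempty, the first [k + 1] of them have more than [k] entries in total, so
    entry [k] can be read off there. *)
Definition concat_sequence (T : Type) (d : T) (l : nat -> seq T) (k : nat) : T :=
  nth d (flatten (mkseq l k.+1)) k.

Lemma flatten_mkseqD (T : Type) (l : nat -> seq T) i j :
  flatten (mkseq l (i + j)) =
  flatten (mkseq l i) ++ flatten (mkseq (fun k => l (i + k)%N) j).
Proof.
rewrite /mkseq iotaD map_cat flatten_cat add0n; congr (_ ++ flatten _).
by rewrite -{1}(addn0 i) iotaDl -map_comp.
Qed.

Lemma concat_sequenceE (T : Type) (d : T) (l : nat -> seq T) i :
  (forall k, 0 < size (l k))%N ->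
  mkseq (concat_sequence d l) (size (flatten (mkseq l i))) = flatten (mkseq l i).
Proof.
move=> l0; have szl k : (k <= size (flatten (mkseq l k)))%N.
  elim: k => // k IH; rewrite -addn1 flatten_mkseqD size_cat /= cats0 addn0.
  exact: leq_add.
apply: (@eq_from_nth _ d) => [|k]; rewrite size_mkseq // => ki.
rewrite nth_mkseq // /concat_sequence.
have [ik|ik] := leqP i k.+1.
- by rewrite -(subnKC ik) flatten_mkseqD nth_cat ki.
- by rewrite -(subnKC (ltnW ik)) flatten_mkseqD nth_cat szl.
Qed.

Definition antichain (P : nat -> option (seq bool * seq bool)) : Prop :=
  forall i j p w q v, P i = Some (p, w) -> P j = Some (q, v) -> prefix p q -> i = j.

(** The oracle concatenates the records. On input [p], each earlier record belongs to an
    incomparable string and leads back to the start state, so the record of [p] runs as if it came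
    first. *)
Lemma interp_program (P : nat -> option (seq bool * seq bool)) : antichain P ->
  exists A, forall i p w, P i = Some (p, w) -> halts_with interp_machine A p w.
Proof.
move=> aP.
(* [[11]] has no effect in state [Live]; it keeps [l i] nonempty where [P i] is undefined. *)
pose l i := if P i is Some (p, w) then record_commands p w else [:: (true, true)].
have l0 i : (0 < size (l i))%N.
  by rewrite /l; case: (P i) => [[p w]|] //; rewrite /record_commands size_cat /= addnS.
pose f := concat_sequence (true, true) l.
pose A : set nat := [set i | if odd i then (f i./2).2 else (f i./2).1].
exists A => i p w Pi.
have AE : oracle_command A =1 f.
  move=> k; rewrite /oracle_command [RHS]surjective_pairing; congr (_, _).
  - by apply/idP/idP; rewrite inE /A /= odd_double doubleK.
  - by apply/idP/idP; rewrite inE /A /= odd_double uphalf_double.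
apply/interp_haltsP; exists (size (flatten (mkseq l i.+1))), (size p).
rewrite /run (eq_mkseq AE) concat_sequenceE // -addn1 flatten_mkseqD foldl_cat.
suff -> : foldl (exec p) (Live, 0%N, [::]) (flatten (mkseq l i)) = (Live, 0%N, [::]).
  by rewrite /= cats0 addn0 /l Pi record_match.
have : forall k, (k < i)%N -> l k = [:: (true, true)] \/
    exists q v, [/\ l k = record_commands q v, ~~ prefix q p & ~~ prefix p q].
  move=> k ki; rewrite /l; case E : (P k) => [[q v]|]; [right|by left].
  exists q, v; split=> //; apply/negP.
  - by move=> /(aP _ _ _ _ _ _ E Pi) ik; rewrite ik ltnn in ki.
  - by move=> /(aP _ _ _ _ _ _ Pi E) ik; rewrite ik ltnn in ki.
elim: i {Pi} => [|i IH] // H.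
rewrite -addn1 flatten_mkseqD foldl_cat IH; last by move=> k ki; apply/H/ltnW.
rewrite /= cats0 addn0; have [->|[q [v [-> qp pq]]]] //= := H i (ltnSn i).
exact: record_mismatch.
Qed.

(** * Names of rational points *)

(* A self-delimiting name: once [m] and [r] are decoded, the length of [b] is
   known. Writing [r] in unary in two parts costs only [r / m + m] bits, which is
   [o(r)] as [m] grows slowly. *)
Definition point_code (m r : nat) (b : seq bool) : seq bool :=
  nseq m true ++ false :: nseq (r %/ m.+1) true ++
  false :: nseq (r %% m.+1) true ++ false :: b.

Lemma size_point_code m r b :
  size (point_code m r b) = (m + r %/ m.+1 + r %% m.+1 + size b + 3)%N.
Proof. by rewrite /point_code; do 3! rewrite size_cat size_nseq /=; lia. Qed.

Lemma unary_prefix m m' (s t : seq bool) :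
  prefix (nseq m true ++ false :: s) (nseq m' true ++ false :: t) ->
  m = m' /\ prefix s t.
Proof. by elim: m m' => [|m IH] [|m'] //= /IH[-> ->]. Qed.

Lemma point_code_prefix m r b m' r' b' :
  prefix (point_code m r b) (point_code m' r' b') ->
  [/\ m = m', r = r' & prefix b b'].
Proof.
move=> /unary_prefix[<-] /unary_prefix[rd] /unary_prefix[rm pb]; split=> //.
by rewrite (divn_eq r m.+1) (divn_eq r' m.+1) rd rm.
Qed.

Lemma blocks_unary a w : blocks (nseq a true ++ false :: w) = a :: blocks w.
Proof. by elim: a => //= a; rewrite -/(blocks _) => ->. Qed.

(** The last delimiter opens one more block, which is empty; hence the final [0]. *)
Lemma blocks_surj (s : seq nat) :
  blocks (flatten [seq rcons (nseq a true) false | a <- s]) = rcons s 0%N.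
Proof. by elim: s => //= a s IH; rewrite cat_rcons blocks_unary IH. Qed.

Lemma rat_triple (q : rat) : exists abc : nat * nat * nat,
  q = (abc.1.1%:R - abc.1.2%:R) / abc.2.+1%:R.
Proof.
have [d dE] : exists d, denq q = d.+1.
  by have := denq_gt0 q; case: (denq q) => [[|d]|d] // _; exists d.
have [a [b abE]] : exists a b : nat, numq q = a%:Z - b%:Z.
  by case: (numq q) => k; [exists k, 0%N; rewrite subr0|exists 0%N, k.+1; rewrite sub0r NegzE].
exists (a, b, d); rewrite -[LHS]divq_num_den dE abE /= rmorphB /=.
by rewrite !pmulrn.
Qed.

Lemma decode_point_surj n (q : 'rV[rat]_n) : exists w, decode_point n w = q.
Proof.
pose t i := projT1 (cid (rat_triple (q ord0 i))).
pose g k := if insub (k %/ 3)%N is Some i then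
  nth 0%N [:: (t i).1.1; (t i).1.2; (t i).2] (k %% 3) else 0%N.
exists (flatten [seq rcons (nseq a true) false | a <- mkseq g (3 * n)]).
apply/rowP => i; rewrite mxE blocks_surj.
rewrite [RHS](projT2 (cid (rat_triple (q ord0 i)))) -/(t i).
have gE k : (k < 3)%N ->
    nth 0%N (rcons (mkseq g (3 * n)) 0%N) (3 * i + k) =
    nth 0%N [:: (t i).1.1; (t i).1.2; (t i).2] k.
  move=> k3; have ik : (3 * i + k < 3 * n)%N by have := ltn_ord i; lia.
  rewrite nth_rcons size_mkseq ik nth_mkseq // /g mulnC divnMDl // divn_small //.
  by rewrite addn0 valK modnMDl modn_small.
by have := gE 0%N isT; rewrite addn0 => ->; rewrite !gE.
Qed.

(** If one name is a prefix of another, then [m] and [r] agree, so both [b] have length [l m r] and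
    agree too. The names thus form an antichain and can be tabulated along an enumeration of the
    triples. *)
Lemma interp_coding n (l : nat -> nat -> nat)
    (q : nat -> nat -> seq bool -> 'rV[rat]_n) :
  exists A, forall m r b, size b = l m r ->
    outputs interp_machine A (point_code m r b) (q m r b).
Proof.
have [name nameK] := choice (@decode_point_surj n).
pose P i := if (pickle_inv i : option (nat * nat * seq bool)) is Some (m, r, b) then
  if size b == l m r then Some (point_code m r b, name (q m r b)) else None
  else None.
have [|A HA] := @interp_program P.
  move=> i j p w p' w'; rewrite /P.
  have := @pickle_invK (nat * nat * seq bool)%type i.
  have := @pickle_invK (nat * nat * seq bool)%type j.
  case: (pickle_inv j) => [[[m' r'] b']|] //= <-.
  case: (pickle_inv i) => [[[m r] b]|] //= <-.
  case: eqP => // sb [<- _]; case: eqP => // sb' [<- _] /point_code_prefix[em er].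
  rewrite -{}em -{}er in sb' *; rewrite prefixE sb -sb' take_size => /eqP ->.
  by [].
exists A => m r b sb; exists (name (q m r b)) => //.
apply: (HA (pickle (m, r, b))).
by rewrite /P pickleK_inv sb eqxx.
Qed.

(** The bound [r %% m.+1 <= m] yields the term [m.*2]; [c] is the optimality constant of the
    interpreter plus the three delimiters of a name. *)
Lemma optimal_coding (R : realType) n V (hV : optimal R n V)
    (l : nat -> nat -> nat) (q : nat -> nat -> seq bool -> 'rV[rat]_n) :
  exists A (c : nat), forall m r b, size b = l m r ->
    (complexity R V A (q m r b) <= (l m r + r %/ m.+1 + m.*2 + c)%:R%:E)%E.
Proof.
have [_ /(_ _ interp_prefix_free)[c Hc]] := hV.
have [A HA] := interp_coding l q.
exists A, (3 + c)%N => m r b sb; apply: le_trans (Hc A (q m r b)) _.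
apply: (@le_trans _ _ ((size (point_code m r b))%:R%:E + c%:R%:E)%E).
  by rewrite leeD2r // ereal_inf_lbound //; exists (point_code m r b) => //; exact: HA.
rewrite -EFinD lee_fin -natrD ler_nat size_point_code sb.
by have := ltn_mod r m.+1; lia.
Qed.

(** * Lower and upper limits as bounds at infinitely many or almost all indices *)

Lemma limn_einf_lt_io (R : realType) (u : (\bar R)^nat) (s : \bar R) :
  (limn_einf u < s)%E -> forall N, exists2 r, (N <= r)%N & (u r < s)%E.
Proof.
rewrite limn_einf_lim (cvg_lim _ (@cvg_einfs_sup _ u)) // => us N.
have /ereal_inf_lt[_ [r /= Nr <-] rs] : (einfs u N < s)%E.
  by apply: le_lt_trans us; apply: ereal_sup_ubound; exists N.
by exists r.
Qed.

Lemma limn_einf_le_io (R : realType) (u : (\bar R)^nat) (s : \bar R) :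
  (forall N, exists2 r, (N <= r)%N & (u r <= s)%E) -> (limn_einf u <= s)%E.
Proof.
move=> H; rewrite limn_einf_lim (cvg_lim _ (@cvg_einfs_sup _ u)) //.
apply: ge_ereal_sup => _ [N _ <-]; have [r Nr rs] := H N.
by apply: le_trans rs; apply: ereal_inf_lbound; exists r.
Qed.

Lemma limn_esup_lt_near (R : realType) (u : (\bar R)^nat) (s : \bar R) :
  (limn_esup u < s)%E -> exists N, forall r, (N <= r)%N -> (u r < s)%E.
Proof.
rewrite limn_esup_lim (cvg_lim _ (@cvg_esups_inf _ u)) //.
move=> /ereal_inf_lt[_ [N _ <-] us]; exists N => r Nr.
by apply: le_lt_trans us; apply: ereal_sup_ubound; exists r.
Qed.

Lemma limn_esup_le_near (R : realType) (u : (\bar R)^nat) (s : \bar R) N :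
  (forall r, (N <= r)%N -> (u r <= s)%E) -> (limn_esup u <= s)%E.
Proof.
move=> H; rewrite limn_esup_lim (cvg_lim _ (@cvg_esups_inf _ u)) //.
apply: (@le_trans _ _ (esups u N)); first by apply: ereal_inf_lbound; exists N.
by apply: ge_ereal_sup => _ [r /= Nr <-]; exact: H.
Qed.

(** * Euclidean norm and counting *)

Section EuclideanNorm.
Variables (R : realType) (n : nat).
Implicit Types (x y c : 'rV[R]_n) (U : set 'rV[R]_n).

Lemma enorm_ge0 x : 0 <= enorm x.
Proof. exact: sqrtr_ge0. Qed.

Lemma enorm_sqr x : enorm x ^+ 2 = \sum_(i < n) x ord0 i ^+ 2.
Proof. by rewrite sqr_sqrtr // sumr_ge0 // => i _; rewrite sqr_ge0. Qed.

Lemma enorm_le x (a : R) : 0 <= a ->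
  (enorm x <= a) = (\sum_(i < n) x ord0 i ^+ 2 <= a ^+ 2).
Proof. by move=> a0; rewrite -enorm_sqr ler_pXn2r ?nnegrE ?enorm_ge0. Qed.

Lemma enormB x y : enorm (x - y) = enorm (y - x).
Proof. by congr Num.sqrt; apply: eq_bigr => i _; rewrite !mxE -sqrrN opprB. Qed.

Lemma enorm0 : enorm (0 : 'rV[R]_n) = 0.
Proof. by rewrite /enorm big1 ?sqrtr0 // => i _; rewrite mxE expr0n. Qed.

(** This form of the triangle inequality comes from (u + v)^2 <= 2 (u^2 + v^2) in each coordinate;
    with a common bound [a] the constant is still sharp. *)
Lemma enormD_le x y (a : R) : enorm x <= a -> enorm y <= a -> enorm (x + y) <= 2 * a.
Proof.
move=> xa ya; have a0 : 0 <= a by apply: le_trans xa; exact: enorm_ge0.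
move: xa ya; rewrite !enorm_le ?mulr_ge0 // => xa ya.
apply: (@le_trans _ _ (\sum_(i < n) 2 * (x ord0 i ^+ 2 + y ord0 i ^+ 2))).
  apply: ler_sum => i _; rewrite mxE -subr_ge0.
  move: (x _ _) (y _ _) => u v.
  have -> : 2 * (u ^+ 2 + v ^+ 2) - (u + v) ^+ 2 = (u - v) ^+ 2 by ring.
  exact: sqr_ge0.
rewrite -mulr_sumr big_split /= exprMn; move: xa ya.
by move: (\sum_(i < n) x _ _ ^+ 2) (\sum_(i < n) y _ _ ^+ 2) => X Y; lra.
Qed.

Lemma enormD_lt x y (a : R) : enorm x < a -> enorm y < a -> enorm (x + y) < 2 * a.
Proof.
move=> xa ya; apply: (@le_lt_trans _ _ (2 * Num.max (enorm x) (enorm y))).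
  by apply: enormD_le; rewrite le_max lexx ?orbT.
by rewrite ltr_pM2l // gt_max xa.
Qed.

Lemma diam_le U c (rho : R) : (forall x, U x -> enorm (x - c) <= rho) ->
  (diam U <= (2 * rho)%:E)%E.
Proof.
move=> H; apply: ge_ereal_sup => _ [[x y] [/= Ux Uy] <-]; rewrite lee_fin.
rewrite -[x](subrK c) -addrA; apply: enormD_le; first exact: H.
by rewrite enormB H.
Qed.

Lemma enorm_le_diam U x y : U x -> U y -> ((enorm (x - y))%:E <= diam U)%E.
Proof. by move=> Ux Uy; apply: ereal_sup_ubound; exists (x, y). Qed.

Lemma diam_closed_eball_ge c (rho : R) : (0 < n)%N -> 0 <= rho ->
  (rho%:E <= diam (closed_eball c rho))%E.
Proof.
move=> n0 r0; pose v : 'rV[R]_n := \row_i (if i == Ordinal n0 then rho else 0).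
have vr : enorm v = rho.
  rewrite /enorm (bigD1 (Ordinal n0)) //= big1 ?addr0 ?mxE ?eqxx ?sqrtr_sqr ?ger0_norm //.
  by move=> i /negbTE i0; rewrite mxE i0 expr0n.
have -> : rho = enorm ((c + v) - c) by rewrite addrC addKr vr.
apply: enorm_le_diam; rewrite /closed_eball /=; first by rewrite addrC !addKr vr.
by rewrite subrr enorm0 enorm_ge0.
Qed.

Lemma rat_approx c (e : R) : 0 < e -> exists q : 'rV[rat]_n, enorm (c - map_mx ratr q) < e.
Proof.
(* Coordinate errors below [e'] give a squared norm of at most n e'^2 <= (n e')^2; dividing by
   [n.+1] also covers [n = 0]. *)
move=> e0; have [e' e'0 e'e] : exists2 e' : R, 0 < e' & n%:R * e' < e.
  exists (e / n.+1%:R); first by rewrite divr_gt0.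
  by rewrite mulrCA gtr_pMr // ltr_pdivrMr // mul1r ltr_nat.
have H i : exists p : rat, `|c ord0 i - ratr p| < e'.
  have [|p] := @rat_in_itvoo R (c ord0 i - e') (c ord0 i + e'); first by lra.
  by rewrite in_itv /= => /andP[p1 p2]; exists p; rewrite ltr_norml; lra.
have {H} [p Hp] := choice H; exists (\row_i p i).
apply: le_lt_trans e'e.
have n0 : 0 <= n%:R :> R by [].
rewrite enorm_le ?mulr_ge0 ?(ltW e'0) //.
apply: (@le_trans _ _ (\sum_(i < n) e' ^+ 2)).
  apply: ler_sum => i _; rewrite !mxE -real_normK ?num_real //.
  by rewrite ler_pXn2r ?nnegrE ?normr_ge0 ?ltW.
rewrite sumr_const card_ord -[leLHS]mulr_natl exprMn ler_pM2r ?exprn_gt0 //.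
by case: (n) => [|k]; rewrite ?expr0n // -natrX ler_nat; exact: leq_pmulr.
Qed.

End EuclideanNorm.

Lemma count_short_strings (s : seq (seq bool)) m : uniq s ->
  (forall p, p \in s -> size p <= m)%N -> (size s <= 2 ^ m.+1)%N.
Proof.
move=> us sm.
(* [L m] lists the strings of length at most [m]. *)
pose L := fix L m : seq (seq bool) := if m is m'.+1 then
  [::] :: map (cons true) (L m') ++ map (cons false) (L m') else [:: [::]].
have sL k : (size (L k) < 2 ^ k.+1)%N.
  by elim: k => //= k; rewrite size_cat !size_map => IH; rewrite expnS; lia.
have mL k p : (size p <= k)%N -> p \in L k.
  elim: k p => [|k IH] [|b p] //= pk; rewrite inE mem_cat /=.
  by case: b; apply/orP; [left|right]; apply/map_f/IH.
apply: leq_trans (ltnW (sL m)); apply: uniq_leq_size => // p /sm; exact: mL.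
Qed.

Lemma bitstring_decoding l : exists e : seq bool -> nat,
  forall i, (i < 2 ^ l)%N -> exists2 b, size b = l & e b = i.
Proof.
pose L : seq (seq bool) := map val (enum {: l.-tuple bool}).
have sL : size L = (2 ^ l)%N by rewrite size_map -cardE card_tuple card_bool.
exists (index^~ L) => i il; exists (nth [::] L i).
  have /mapP[t _ ->] : nth [::] L i \in L by rewrite mem_nth // sL.
  by rewrite size_tuple.
by rewrite index_uniq ?sL // map_inj_uniq ?enum_uniq //; exact: val_inj.
Qed.

Lemma exists_maximal_seq (T : Type) (P : seq T -> Prop) (N : nat) : P [::] ->
  (forall s, P s -> size s <= N)%N -> exists2 s, P s & forall x, ~ P (x :: s).
Proof.
move=> P0 PN; apply: contrapT => H.
have {}H s : P s -> exists x, P (x :: s).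
  by move=> Ps; apply: contrapT => nx; apply: H; exists s => // x Px; apply: nx; exists x.
have [s Ps sN] : exists2 s, P s & size s = N.+1.
  elim: (N.+1) => [|k [s Ps sk]]; first by exists [::].
  by have [x Px] := H _ Ps; exists (x :: s) => //=; rewrite sk.
by have := PN _ Ps; rewrite sN ltnn.
Qed.

(** * Powers of two, geometric series and dyadic scales *)

Lemma powR_exp2N (R : realType) (s : R) k : (2 ^- k) `^ s = 2 `^ (- s * k%:R).
Proof. by rewrite -powR_invn // -powRrM mulNr mulrC mulNr mulrC. Qed.

Lemma powR2_lt1 (R : realType) (s s' : R) : s < s' -> 0 <= 2 `^ (s - s') < 1.
Proof.
move=> ss'; rewrite powR_ge0 /= -[X in _ < X](powRr0 2) /powR pnatr_eq0 /= ltr_expR.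
by rewrite ltr_pM2r ?subr_lt0 // ln_gt0 // ltr1n.
Qed.

Lemma geometric_tail_le (R : realType) (z : R) k M : 0 <= z < 1 ->
  \sum_(k <= r < M) z ^+ r <= z ^+ k / (1 - z).
Proof.
move=> /andP[z0 z1]; have z1' : 0 < 1 - z by rewrite subr_gt0.
rewrite ler_pdivlMr //; have [kM|Mk] := leqP k M; last first.
  by rewrite big_geq ?mul0r ?exprn_ge0 // ltnW.
suff -> : (\sum_(k <= r < M) z ^+ r) * (1 - z) = z ^+ k - z ^+ M.
  by rewrite gerBl exprn_ge0.
rewrite -(subnKC kM); elim: (M - k)%N => [|d IH].
  by rewrite addn0 big_geq // mul0r subrr.
rewrite addnS big_nat_recr ?leq_addr //= mulrDl IH exprS; ring.
Qed.

Lemma geometric_le_eventually (R : realType) (C z e : R) N : 0 <= z < 1 -> 0 < e ->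
  exists2 k, (N <= k)%N & C * z ^+ k <= e.
Proof.
move=> /andP[z0 z1] e0.
have /cvgrPdist_le/(_ e e0)[K _ HK] : geometric C z @ \oo --> 0.
  by apply: cvg_geometric; rewrite ger0_norm.
exists (maxn N K); first exact: leq_maxl.
have := HK (maxn N K) (leq_maxr _ _); rewrite /= sub0r normrN.
exact/le_trans/ler_norm.
Qed.

Lemma dyadic_scale (R : realType) (d : R) k : 0 < d <= 2 ^- k ->
  exists2 r, (k <= r)%N & 2 ^- r <= d < 2 * 2 ^- r.
Proof.
move=> /andP[d0 dk].
have half : 0 <= (2^-1 : R) < 1 by apply/andP; split; lra.
have ex : exists r, 2 ^- r <= d.
  have [r _ rd] := @geometric_le_eventually R 1 2^-1 d 0 half d0.
  by exists r; rewrite -exprVn -[leLHS]mul1r.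
case: (ex_minnP ex) => r rd rmin; exists r.
  rewrite leqNgt; apply/negP => rk.
  have : 2 ^- k < 2 ^- r :> R by rewrite ltf_pV2 ?posrE ?exprn_gt0 // ltr_eXn2l ?ltr1n.
  by rewrite ltNge (le_trans rd dk).
(* For [r > 0] the upper bound is the minimality of [r]; for [r = 0] it follows from
   [d <= 2 ^- k <= 1]. *)
rewrite rd /=; case: r rd rmin => [|r] rd rmin.
  rewrite expr0 invr1 mulr1 (le_lt_trans dk) // (@le_lt_trans _ _ 1) ?ltr1n //.
  by rewrite invf_le1 ?exprn_gt0 // exprn_ege1 // ler1n.
rewrite exprS invfM mulrA divff ?mul1r // ltNge; apply/negP => dr.
by have := rmin r dr; rewrite ltnn.
Qed.

(* At each level [r] at most [2 * 2 ^ (s * r)] programs are short enough, so the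
   sum is dominated by a geometric series of ratio [2 ^ (s - s')]. *)
Lemma esum_program_bound (R : realType) (I : set nat) (f : nat -> \bar R)
    (lv : nat -> nat) (prog : nat -> seq bool) (s s' C : R) k :
  0 <= s -> s < s' -> 0 <= C ->
  (forall i, I i -> (0 <= f i <= (C * 2 `^ (- s' * (lv i)%:R))%:E)%E) ->
  (forall i, I i -> (k <= lv i)%N /\ (size (prog i))%:R <= s * (lv i)%:R) ->
  (forall i j, I i -> I j -> lv i = lv j -> prog i = prog j -> i = j) ->
  (\esum_(i in I) f i <= (C * 2 / (1 - 2 `^ (s - s')) * (2 `^ (s - s')) ^+ k)%:E)%E.
Proof.
move=> s0 ss' C0 fC klv inj; set z := 2 `^ (s - s').
have z01 : 0 <= z < 1 by exact: powR2_lt1.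
apply: ge_ereal_sup => _ [F [finF FI] <-]; rewrite fsbig_finite //=.
set t : seq nat := finmap.enum_fset (fset_set F).
have tI i : i \in t -> I i by move=> it; apply: FI; rewrite -in_setE -in_fset_set.
have ut : uniq t by exact: finmap.fset_uniq.
pose g r := C * 2 `^ (- s' * r%:R).
have g0 r : 0 <= g r by rewrite mulr_ge0 // powR_ge0.
apply: (@le_trans _ _ (\sum_(i <- t) (g (lv i))%:E)%E).
  rewrite big_seq [leRHS]big_seq; apply: lee_sum => i /tI Ii.
  by have /andP[_] := fC i Ii.
rewrite sumEFin lee_fin.
pose M := (\max_(i <- t) lv i).+1.
(* The terms of a finite partial sum are grouped by level. *)
have -> : \sum_(i <- t) g (lv i) =
    \sum_(k <= r < M) (count (fun i => lv i == r) t)%:R * g r.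
  rewrite big_seq (eq_bigr (fun i => \sum_(k <= r < M) (lv i == r)%:R * g r)).
    rewrite -big_seq exchange_big /=; apply: eq_bigr => r _.
    rewrite -mulr_suml -sum1_count natr_sum [in RHS]big_mkcond /=; congr (_ * _).
    by apply: eq_bigr => i _; case: eqP.
  move=> i it; have lvM : (k <= lv i < M)%N.
    by rewrite (klv _ (tI _ it)).1 ltnS (leq_bigmax_seq _ it).
  rewrite (bigD1_seq (lv i)) ?iota_uniq ?mem_index_iota //= eqxx mul1r.
  by rewrite big1 ?addr0 // => r /negbTE; rewrite eq_sym => ->; rewrite mul0r.
apply: (@le_trans _ _ (\sum_(k <= r < M) C * 2 * z ^+ r)); last first.
  rewrite -mulr_sumr [leRHS]mulrAC -[leRHS]mulrA ler_wpM2l ?mulr_ge0 //.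
  exact: geometric_tail_le.
apply: ler_sum => r _.
have cnt : (count (fun i => lv i == r) t)%:R <= 2 * 2 `^ (s * r%:R).
  have sr0 : 0 <= s * r%:R by rewrite mulr_ge0.
  apply: (@le_trans _ _ (2 ^ (Num.truncn (s * r%:R)).+1)%:R).
    rewrite ler_nat -size_filter -(size_map prog); apply: count_short_strings.
      rewrite map_inj_in_uniq ?filter_uniq // => i j.
      rewrite !mem_filter => /andP[/eqP ir /tI Ii] /andP[/eqP jr /tI Ij].
      by apply: inj; rewrite // ir jr.
    move=> p /mapP[i]; rewrite mem_filter => /andP[/eqP ir /tI Ii] ->.
    by rewrite truncn_ge_nat // -ir; have [] := klv _ Ii.
  rewrite natrX exprS ler_pM2l // -powR_mulrn // ler_powR ?ler1n //.
  by rewrite truncn_le.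
rewrite /g (_ : C * 2 * z ^+ r = 2 * 2 `^ (s * r%:R) * (C * 2 `^ (- s' * r%:R))).
  by rewrite ler_wpM2r // g0.
rewrite -powR_mulrn ?powR_ge0 // -powRrM mulrBl powRD ?pnatr_eq0 ?implybT //.
rewrite mulNr; ring.
Qed.

(** * Lower bounds on the complexity densities *)

Section Contents.
Variables (R : realType) (n : nat).
Implicit Types (E F : set 'rV[R]_n) (s d : R) (V : oracle_machine) (A : set nat).

(** Shrinking [d] leaves fewer covers, so the contents increase to their supremum. *)
Lemma hausdorff_measureE s E :
  hausdorff_measure s E = ereal_sup [set hausdorff_content s d E | d in [set d | 0 < d]].
Proof.
rewrite (_ : [set d | 0 < d] = [set` Interval (BRight 0) (BInfty R false)]).
  apply/cvg_lim => //; apply: nonincreasing_at_right_cvge => //.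
  move=> d e _ _ de; apply: le_ereal_inf => h [I [U [[EU UI] hE]]].
  exists I, U; split=> //; split=> // i Ii; have /andP[-> /=] := UI i Ii.
  by move=> /le_trans; apply; rewrite lee_fin.
by apply/seteqP; split=> x /=; rewrite in_itv /= andbT.
Qed.

(** Shrinking [d] leaves fewer packings, so the contents decrease to their infimum. *)
Lemma packing_premeasureE s E :
  packing_premeasure s E = ereal_inf [set packing_content s d E | d in [set d | 0 < d]].
Proof.
rewrite (_ : [set d | 0 < d] = [set` Interval (BRight 0) (BInfty R false)]).
  apply/cvg_lim => //; apply: nondecreasing_at_right_cvge => //.
  move=> d e _ _ de; apply: le_ereal_sup => h [I [c [rho [[EU UI] hE]]]].
  exists I, c, rho; split=> //; split=> // i Ii; have [Ec /andP[r0 rd]] := EU i Ii.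
  by split=> //; rewrite r0 (le_trans rd).
by apply/seteqP; split=> x /=; rewrite in_itv /= andbT.
Qed.

Lemma hausdorff_content_ge0 s d E : (0 <= hausdorff_content s d E)%E.
Proof.
apply: le_ereal_inf_tmp => _ [I [U [_ ->]]].
by apply: esum_ge0 => i _; exact: poweR_ge0.
Qed.

Lemma packing_content_ge0 s d E : (0 <= packing_content s d E)%E.
Proof.
apply: ereal_sup_ubound; exists set0, (fun=> 0), (fun=> 0); split=> //.
  by split=> // i j [].
by rewrite esum_set0.
Qed.

Lemma hausdorff_measure_eq0 s E :
  (forall d, 0 < d -> hausdorff_content s d E = 0%E) -> hausdorff_measure s E = 0%E.
Proof.
move=> H; rewrite hausdorff_measureE; apply/eqP; rewrite eq_le; apply/andP; split.
  by apply: ge_ereal_sup => _ [d /= d0 <-]; rewrite H.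
by apply: ereal_sup_ubound; exists 1 => /=; rewrite ?H ?ltr01.
Qed.

Lemma packing_premeasure_ge0 s E : (0 <= packing_premeasure s E)%E.
Proof.
rewrite packing_premeasureE; apply: le_ereal_inf_tmp => _ [d _ <-].
exact: packing_content_ge0.
Qed.

Lemma outputs_inj (M : oracle_machine) A p (q q' : 'rV[rat]_n) :
  outputs M A p q -> outputs M A p q' -> q = q'.
Proof. by move=> [w pw <-] [w' pw' <-]; rewrite (halts_with_inj pw pw'). Qed.

Lemma point_complexity_lt V A s r (x : 'rV[R]_n) : (0 < r)%N ->
  (point_complexity V A r x / r%:R%:E < s%:E)%E ->
  exists p q, [/\ outputs V A p q, enorm (x - map_mx ratr q) < 2 ^- r &
    (size p)%:R <= s * r%:R].
Proof.
move=> r0; rewrite inver pnatr_eq0 eqn0Ngt r0 /= lte_pdivrMr ?ltr0n // -EFinM.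
move=> /ereal_inf_lt[_ [q /= qx <-]] /ereal_inf_lt[_ [p /= pq <-]].
by rewrite lte_fin => /ltW ps; exists p, q.
Qed.

Hypothesis n_gt0 : (0 < n)%N.

Lemma poweR_diam_le (U : set 'rV[R]_n) (a s : R) k : 0 <= s -> 0 <= a ->
  (0 <= diam U <= (a * 2 ^- k)%:E)%E ->
  (0 <= poweR (diam U) s <= (a `^ s * 2 `^ (- s * k%:R))%:E)%E.
Proof.
move=> s0 a0 /andP[d0 dk]; rewrite poweR_ge0 /= -powR_exp2N.
rewrite -powRM ?invr_ge0 ?exprn_ge0 // -poweR_EFin.
apply: gt0_ler_poweR => //; rewrite in_itv /= ?d0 ?leey //.
by rewrite (le_trans d0 dk).
Qed.

Lemma exp2_le_eventually d : 0 < d -> exists N, forall r, (N <= r)%N -> 2 * 2 ^- r <= d.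
Proof.
move=> d0; have half : 0 <= (2^-1 : R) < 1 by apply/andP; split; lra.
have [N _ HN] := geometric_le_eventually 2 0 half d0.
exists N => r Nr; apply: le_trans HN; rewrite ler_pM2l // exprVn.
by rewrite lef_pV2 ?posrE ?exprn_gt0 // ler_eXn2l ?ltr1n.
Qed.

Lemma lower_complexity_density_null V A E s s' : 0 <= s -> s < s' ->
  (forall x, E x -> (lower_complexity_density V A x < s%:E)%E) ->
  hausdorff_measure s' E = 0%E.
Proof.
move=> s0 ss' HE; have s'0 := le_trans s0 (ltW ss').
apply: hausdorff_measure_eq0 => d d0; apply/eqP; rewrite eq_le hausdorff_content_ge0 andbT.
apply/lee_addgt0Pr => e e0; rewrite add0e.
have z01 := powR2_lt1 ss'.
have [N HN] := exp2_le_eventually d0.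
(* From level [k] on the balls have diameter at most [d] and the geometric bound is at most [e]; the
   [1] keeps the divisor [r] positive. *)
have [k Nk ke] := geometric_le_eventually (2 `^ s' * 2 / (1 - 2 `^ (s - s')))
  (maxn 1 N) z01 e0.
move: Nk; rewrite geq_max => /andP[k1 Nk].
pose dec i : nat * seq bool := odflt (0%N, [::]) (pickle_inv i).
have decK x : dec (pickle x) = x by rewrite /dec pickleK_inv.
(* An index stands for a level and a program; the first condition discards numbers that are not
   codes and makes [dec] injective on [I]. *)
pose I := [set i | [/\ pickle (dec i) = i, (k <= (dec i).1)%N,
  (size (dec i).2)%:R <= s * (dec i).1%:R &
  exists q : 'rV[rat]_n, outputs V A (dec i).2 q]].
(* A program has at most one output, so [xget] returns that one if it exists; [0] is a
   placeholder. *)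
pose c i : 'rV[R]_n := map_mx ratr (xget 0 [set q | outputs V A (dec i).2 q]).
pose U i := closed_eball (c i) (2 ^- (dec i).1).
have dU i : (0 < diam (U i))%E.
  have r0 : (0 : R) < 2 ^- (dec i).1 by rewrite invr_gt0 exprn_gt0.
  by apply: lt_le_trans (diam_closed_eball_ge (c i) n_gt0 (ltW r0)); rewrite lte_fin.
have dU2 i : (diam (U i) <= (2 * 2 ^- (dec i).1)%:E)%E by apply: (@diam_le _ _ _ (c i)).
apply: (@le_trans _ _ (\esum_(i in I) poweR (diam (U i)) s')).
  apply: ereal_inf_lbound; exists I, U; split=> //; split.
    move=> x Ex; have [r kr /point_complexity_lt] := limn_einf_lt_io (HE x Ex) k.
    move=> /(_ (leq_trans k1 kr))[p [q [pq xq ps]]].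
    exists (pickle (r, p)); first by rewrite /I /= decK; split=> //; exists q.
    rewrite /U /c decK /= /closed_eball /=; case: xgetP => [q' -> /= pq'|/(_ q)//].
    by rewrite (outputs_inj pq' pq) ltW.
  move=> i [_ ki _ _]; rewrite dU /=; apply: le_trans (dU2 i) _.
  by rewrite lee_fin HN // (leq_trans Nk).
apply: (@le_trans _ _ (2 `^ s' * 2 / (1 - 2 `^ (s - s')) * 2 `^ (s - s') ^+ k)%:E).
  apply: (@esum_program_bound _ I _ (fst \o dec) (snd \o dec)) => //=.
  - by move=> i _; apply: poweR_diam_le => //; rewrite (ltW (dU i)) dU2.
  - by move=> i [].
  - move=> i j [iE _ _ _] [jE _ _ _] e1 e2.
    by rewrite -iE -jE [dec i]surjective_pairing e1 e2 -surjective_pairing.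
by rewrite lee_fin.
Qed.

Lemma upper_complexity_density_null V A E s s' : 0 <= s -> s < s' ->
  (forall x, E x -> (upper_complexity_density V A x < s%:E)%E) ->
  packing_measure s' E = 0%E.
Proof.
move=> s0 ss' HE; have s'0 := le_trans s0 (ltW ss').
(* A packing mixes many centres and radii, so the threshold must not depend on the point: [E] is the
   countable union of pieces with a common threshold. *)
pose F j := [set x | E x /\ forall r, (j < r)%N ->
  (point_complexity V A r x / r%:R%:E < s%:E)%E].
suff F0 j : packing_premeasure s' (F j) = 0%E.
  apply/eqP; rewrite eq_le; apply/andP; split; last first.
    apply: le_ereal_inf_tmp => _ [G _ <-]; apply: nneseries_ge0 => i _ _.
    exact: packing_premeasure_ge0.
  apply: ereal_inf_lbound; exists F; last by apply: eseries0 => i _ _; exact: F0.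
  move=> x Ex; have [N HN] := limn_esup_lt_near (HE x Ex).
  by exists N => //; split=> // r /ltnW; exact: HN.
apply/eqP; rewrite eq_le packing_premeasure_ge0 andbT.
apply/lee_addgt0Pr => e e0; rewrite add0e.
have z01 := powR2_lt1 ss'.
(* The [4] comes from diam <= 2 rho < 4 * 2^-r, with [r] the dyadic level of the radius. *)
have [k jk ke] := geometric_le_eventually (4 `^ s' * 2 / (1 - 2 `^ (s - s')))
  j.+1 z01 e0.
rewrite packing_premeasureE.
apply: (@le_trans _ _ (packing_content s' (2 ^- k) (F j))).
  by apply: ereal_inf_lbound; exists (2 ^- k) => //=; rewrite invr_gt0 exprn_gt0.
apply: ge_ereal_sup => _ [I [c [rho [[FI tI] ->]]]].
pose P i (x : nat * seq bool) := [/\ (k <= x.1)%N, 2 ^- x.1 <= rho i < 2 * 2 ^- x.1,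
  (size x.2)%:R <= s * x.1%:R & exists2 q : 'rV[rat]_n, outputs V A x.2 q &
  enorm (c i - map_mx ratr q) < 2 ^- x.1].
have [lp Hlp] : exists lp, forall i, I i -> P i (lp i).
  suff H i : exists x, I i -> P i x by have [lp] := choice H; exists lp.
  have [Ii|nI] := pselect (I i); last by exists (0%N, [::]).
  have [[_ Fi] ri] := FI i Ii; have [r kr rr] := dyadic_scale ri.
  have jr : (j < r)%N by exact: leq_trans kr.
  have [p [q [pq cq ps]]] := point_complexity_lt (leq_ltn_trans (leq0n j) jr) (Fi r jr).
  by exists (r, p) => _; split=> //; exists q.
apply: (@le_trans _ _ (4 `^ s' * 2 / (1 - 2 `^ (s - s')) * 2 `^ (s - s') ^+ k)%:E).
  apply: (@esum_program_bound _ I _ (fst \o lp) (snd \o lp)) => //=.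
  - move=> i Ii; apply: poweR_diam_le => //; have [_ /andP[rl ru] _ _] := Hlp i Ii.
    have r0 : 0 <= rho i by apply: le_trans rl; rewrite invr_ge0 exprn_ge0.
    apply/andP; split.
      apply: le_trans (diam_closed_eball_ge (c i) n_gt0 r0).
      by rewrite lee_fin.
    apply: le_trans (@diam_le _ _ _ (c i) (rho i) _) _; first by [].
    by rewrite lee_fin; move: (2 ^- _) ru => z; lra.
  - by move=> i /Hlp[].
  - move=> i i' Ii Ii' e1 e2.
    (* Equal levels and programs give the same rational point. It lies in both balls, whose radii
       are at least [2 ^- r], so disjointness forces [i = i']. *)
    have [_ /andP[rl _] _ [q pq cq]] := Hlp i Ii.
    have [_ /andP[rl' _] _ [q' pq' cq']] := Hlp i' Ii'.
    apply: (tI i i' Ii Ii'); exists (map_mx ratr q); split.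
      by rewrite /closed_eball /= enormB (le_trans (ltW cq)).
    rewrite e2 in pq; rewrite (outputs_inj pq pq').
    by rewrite /closed_eball /= enormB (le_trans (ltW cq')).
by rewrite lee_fin.
Qed.

End Contents.

(** * Oracles attaining the dimensions *)

Lemma esum_ge_size (R : realType) (I : set nat) (f : nat -> \bar R) (t : seq nat) (a : R) :
  uniq t -> (forall i, i \in t -> I i /\ (a%:E <= f i)%E) ->
  (((size t)%:R * a)%:E <= \esum_(i in I) f i)%E.
Proof.
move=> ut H; apply: (@le_trans _ _ (\sum_(i \in [set` t]) f i)%E).
  have -> : (size t)%:R * a = \sum_(i <- t) a.
    by rewrite big_const_seq count_predT iter_addr addr0 mulr_natl.
  rewrite -fsbig_seq // -sumEFin big_seq [leRHS]big_seq; apply: lee_sum => i it.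
  by have [_] := H i it.
apply: ereal_sup_ubound; exists [set` t] => //; split; first exact: finite_seq.
by move=> i /= /H[].
Qed.

(** Bounds the number of sets of diameter at least [2 ^- k] in a family whose [s]-th powers sum to
    at most 1, by a power of two so that an index takes a whole number of bits. *)
Lemma natr_le_exp_truncn (R : realType) (s : R) (k N : nat) :
  0 <= s -> N%:R * (2 ^- k) `^ s <= 1 -> (N <= 2 ^ (Num.truncn (s * k%:R)).+1)%N.
Proof.
move=> s0; rewrite powR_exp2N mulNr powRN ler_pdivrMr ?powR_gt0 // mul1r => NB.
rewrite -(ler_nat R) (le_trans NB) // natrX -powR_mulrn // ler_powR ?ler1n //.
exact/ltW/truncnS_gt.
Qed.

(** A point is named by its index in [L m r], written with exactly [l m r] bits; strings decoded
    past the end of the list name the point [0]. *)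
Lemma optimal_coding_seq (R : realType) n V (hV : optimal R n V)
    (l : nat -> nat -> nat) (L : nat -> nat -> seq 'rV[rat]_n) :
  (forall m r, size (L m r) <= 2 ^ l m r)%N ->
  exists A (c : nat), forall m r q, q \in L m r ->
    (complexity R V A q <= (l m r + r %/ m.+1 + m.*2 + c)%:R%:E)%E.
Proof.
move=> sL; have [e He] := choice bitstring_decoding.
have [A [c Hc]] := optimal_coding hV l (fun m r b => nth 0 (L m r) (e (l m r) b)).
exists A, c => m r q qL.
have [|b sb eb] := He (l m r) (index q (L m r)).
  by rewrite (leq_trans _ (sL m r)) // index_mem.
by have := Hc m r b sb; rewrite eb nth_index.
Qed.

(* The constant [5] collects [1] from [s - D], [1] from [r %/ m.+1] and [3] from the
   remaining terms, which add up to at most [3 * m]. *)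
Lemma program_length_le (R : realType) (D s : R) (c k m r : nat) :
  0 <= D -> 0 <= s -> s <= D + k.+1%:R^-1 -> 3 * (D + 1) + 1 + c%:R <= k%:R ->
  (k <= m)%N -> (m * m.+1 <= r)%N ->
  ((Num.truncn (s * (r + 3)%:R)).+1 + r %/ m.+1 + m.*2 + c)%:R <=
    (D + 5 / k.+1%:R) * r%:R.
Proof.
move=> D0 s0 sD ck km mr.
have k0 : 0 < k.+1%:R^-1 :> R by rewrite invr_gt0.
have k1 : k.+1%:R^-1 <= 1 :> R by rewrite invf_le1 // ler1n.
have Ht : (Num.truncn (s * (r + 3)%:R))%:R <= s * (r + 3)%:R.
  by rewrite truncn_le mulr_ge0.
have mk : m.+1%:R^-1 <= k.+1%:R^-1 :> R by rewrite lef_pV2 ?posrE // ler_nat.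
have Hd : (r %/ m.+1)%:R <= k.+1%:R^-1 * r%:R :> R.
  apply: (@le_trans _ _ (m.+1%:R^-1 * r%:R)); last by rewrite ler_wpM2r.
  by rewrite mulrC ler_pdivlMr // -natrM ler_nat leq_trunc_div.
have Hm : m%:R <= k.+1%:R^-1 * r%:R :> R.
  apply: (@le_trans _ _ (m.+1%:R^-1 * r%:R)); last by rewrite ler_wpM2r.
  by rewrite mulrC ler_pdivlMr // -natrM ler_nat.
have kmR : k%:R <= m%:R :> R by rewrite ler_nat.
rewrite -addn1 -muln2 !natrD natrM.
move: Ht; rewrite natrD; move: (_%:R^-1) k0 k1 mk Hd Hm sD => u k0 k1 mk Hd Hm sD Ht.
have r0 : 0 <= r%:R :> R by [].
have sr : s * (r%:R + 3) <= (D + u) * r%:R + 3 * (D + 1).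
  rewrite mulrDr lerD // ?ler_wpM2r //; lra.
lra.
Qed.

(** * Few rational points approximating a cover or a packing piece at one scale *)

Section Coverings.
Variables (R : realType) (n : nat).
Implicit Types (s : R).

Lemma rat_approx_fun : exists g : R -> 'rV[R]_n -> 'rV[rat]_n,
  forall e c, 0 < e -> enorm (c - map_mx ratr (g e c)) < e.
Proof.
suff H (ec : R * 'rV[R]_n) : exists q, 0 < ec.1 -> enorm (ec.2 - map_mx ratr q) < ec.1.
  by have [g Hg] := choice H; exists (fun e c => g (e, c)) => e c; exact: (Hg (e, c)).
have [e0|e0] := ltP 0 ec.1; last by exists 0.
by have [q Hq] := rat_approx ec.2 e0; exists q.
Qed.

Lemma exp2N_add r j : 2 ^- r = 2 ^+ j * 2 ^- (r + j) :> R.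
Proof. by rewrite exprD invfM mulrCA mulrV ?mulr1 ?unitfE ?expf_neq0. Qed.

(** A set of diameter below [2 ^- (r + 1)] is represented by a rational point that close to one of
    its elements, hence within [2 ^- r] of all of them. The bounded sum limits the number of such
    sets. *)
Lemma cover_level_points s (I : set nat) (U : nat -> set 'rV[R]_n) r : 0 <= s ->
  (\esum_(i in I) poweR (diam (U i)) s <= 1)%E ->
  exists2 L : seq 'rV[rat]_n, (size L <= 2 ^ (Num.truncn (s * (r + 3)%:R)).+1)%N &
    forall i x, I i -> U i x ->
      ((2 ^- (r + 2))%:E <= diam (U i) < (2 * 2 ^- (r + 2))%:E)%E ->
      exists2 q, q \in L & enorm (x - map_mx ratr q) < 2 ^- r.
Proof.
move=> s0 sum1; have [g Hg] := rat_approx_fun.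
pose lvl i := I i /\ ((2 ^- (r + 2))%:E <= diam (U i) < (2 * 2 ^- (r + 2))%:E)%E.
pose P t := uniq t /\ forall i, i \in t -> lvl i.
have bnd t : P t -> (size t <= 2 ^ (Num.truncn (s * (r + 3)%:R)).+1)%N.
  move=> [ut tl]; apply: natr_le_exp_truncn => //.
  rewrite -lee_fin (le_trans _ sum1) //; apply: esum_ge_size => // i /tl[Ii /andP[dl du]].
  split=> //; have fd : diam (U i) \is a fin_num.
    rewrite ge0_fin_numE ?(lt_trans du) ?ltry //.
    by apply: le_trans dl; rewrite lee_fin invr_ge0 exprn_ge0.
  move: dl; rewrite -(fineK fd) poweR_EFin !lee_fin => dl.
  (* The weaker exponent [r + 3] gives the same list length as for packings, so [program_length_le]
     serves both. *)
  have dl' : 2 ^- (r + 3) <= fine (diam (U i)).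
    apply: le_trans dl; rewrite lef_pV2 ?posrE ?exprn_gt0 //.
    by rewrite ler_eXn2l ?ltr1n // leq_add2l.
  have p0 : 0 <= 2 ^- (r + 3) :> R by rewrite invr_ge0 exprn_ge0.
  by apply: ge0_ler_powR => //; rewrite nnegrE // (le_trans p0).
have [|t Pt tmax] := exists_maximal_seq _ bnd; first by [].
have [ut tl] := Pt.
exists [seq g (2 ^- (r + 1)) (xget 0 (U i)) | i <- t]; first by rewrite size_map bnd.
move=> i x Ii Uix di.
(* A maximal list of indices of this level contains them all. *)
have it : i \in t.
  apply: contrapT => /negP it; apply: (tmax i); split; first by rewrite /= it.
  by move=> j; rewrite inE => /predU1P[->|/tl].
exists (g (2 ^- (r + 1)) (xget 0 (U i))); first by apply/mapP; exists i.
set z := xget 0 (U i); have Uz : U i z by apply: (xgetPex 0); exists x.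
rewrite -[x](subrK z) -addrA (exp2N_add r 1) expr1; apply: enormD_lt.
  have /andP[_ du] := di.
  rewrite -lte_fin (le_lt_trans (enorm_le_diam Uix Uz)) // (lt_le_trans du) //.
  by rewrite lee_fin (exp2N_add (r + 1) 1) expr1 -addnA.
by apply: Hg; rewrite invr_gt0 exprn_gt0.
Qed.

End Coverings.

Section Upper.
Variables (R : realType) (n : nat).
Implicit Types (E F : set 'rV[R]_n) (s d : R).
Hypothesis n_gt0 : (0 < n)%N.

(** Balls of radius [2 ^- (r + 3)] around points more than twice that apart form a packing, so the
    content bounds their number. A maximal such list comes within [2 ^- (r + 2)] of every point of
    [F]. *)
Lemma packing_level_points s d F r : 0 <= s -> (packing_content s d F <= 1)%E ->
  2 ^- (r + 3) <= d ->
  exists2 L : seq 'rV[rat]_n, (size L <= 2 ^ (Num.truncn (s * (r + 3)%:R)).+1)%N &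
    forall x, F x -> exists2 q, q \in L & enorm (x - map_mx ratr q) < 2 ^- r.
Proof.
move=> s0 cont1 rd; have [g Hg] := rat_approx_fun R n.
have rho0 : 0 < 2 ^- (r + 3) :> R by rewrite invr_gt0 exprn_gt0.
pose far (x y : 'rV[R]_n) := 2 * 2 ^- (r + 3) < enorm (x - y).
pose P t := (forall x, x \in t -> F x) /\ pairwise far t.
have bnd t : P t -> (size t <= 2 ^ (Num.truncn (s * (r + 3)%:R)).+1)%N.
  move=> [tF /(pairwiseP 0) tfar]; apply: natr_le_exp_truncn => //.
  pose B i := closed_eball (nth 0 t i) (2 ^- (r + 3)).
  rewrite -lee_fin (le_trans _ cont1) //.
  apply: (@le_trans _ _ (\esum_(i in [set i | (i < size t)%N]) poweR (diam (B i)) s)).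
    rewrite -[in leLHS](size_iota 0 (size t)); apply: esum_ge_size; first exact: iota_uniq.
    move=> i; rewrite mem_iota /= => it; split=> //.
    rewrite -poweR_EFin; apply: gt0_ler_poweR => //.
    + by rewrite in_itv /= leey lee_fin ltW.
    + rewrite in_itv /= leey andbT.
      apply: le_trans (diam_closed_eball_ge _ n_gt0 (ltW rho0)).
      by rewrite lee_fin ltW.
    + exact: (diam_closed_eball_ge _ n_gt0 (ltW rho0)).
  apply: ereal_sup_ubound; exists [set i | (i < size t)%N], (nth 0 t), (fun=> 2 ^- (r + 3)).
  split=> //; split=> [i /= it|]; first by rewrite rho0 rd; split=> //; exact/tF/mem_nth.
  have sep i j : (i < j)%N -> (j < size t)%N -> ~ (B i `&` B j !=set0).
    move=> ij jt [z [zi zj]]; have := tfar i j (ltn_trans ij jt) jt ij.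
    rewrite /far ltNge => /negP; apply.
    rewrite -[nth 0 t i](subrK z) -addrA; apply: enormD_le => //.
    by rewrite enormB.
  move=> i j /= it jt Bij; have [ij|ji|//] := ltngtP i j.
  - by case: (sep i j ij jt).
  - by rewrite setIC in Bij; case: (sep j i ji it).
have [|t Pt tmax] := exists_maximal_seq _ bnd; first by [].
have [tF tfar] := Pt.
exists [seq g (2 ^- (r + 1)) y | y <- t]; first by rewrite size_map bnd.
move=> x Fx; have [y yt xy] : exists2 y, y \in t & enorm (x - y) <= 2 * 2 ^- (r + 3).
  apply: contrapT => H; apply: (tmax x); split.
    by move=> z; rewrite inE => /predU1P[->|/tF].
  rewrite /= tfar andbT; apply/allP => y yt; rewrite /far ltNge; apply/negP => xy.
  by apply: H; exists y.
exists (g (2 ^- (r + 1)) y); first exact: map_f.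
rewrite -[x](subrK y) -addrA (exp2N_add R r 1) expr1; apply: enormD_lt.
  apply: le_lt_trans xy _; rewrite (exp2N_add R (r + 1) 2) -addnA ltr_pM2r //.
  by rewrite expr2; lra.
by apply: Hg; rewrite invr_gt0 exprn_gt0.
Qed.

Lemma point_complexity_le V (A : set nat) r (x : 'rV[R]_n) q (N : nat) (a : R) :
  (0 < r)%N -> (complexity R V A q <= N%:R%:E)%E ->
  enorm (x - map_mx ratr q) < 2 ^- r -> N%:R <= a * r%:R ->
  (point_complexity V A r x / r%:R%:E <= a%:E)%E.
Proof.
move=> r0 Vq xq Na; rewrite inver pnatr_eq0 eqn0Ngt r0 /= lee_pdivrMr ?ltr0n // -EFinM.
apply: (@le_trans _ _ (complexity R V A q)); first by apply: ereal_inf_lbound; exists q.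
by apply: le_trans Vq _; rewrite lee_fin.
Qed.

Lemma minimizing_exponents (null : R -> Prop) (D : R) :
  ereal_inf [set s%:E | s in [set s : R | 0 <= s /\ null s]] = D%:E ->
  exists s : nat -> R, forall k, [/\ 0 <= s k, null (s k) & s k <= D + k.+1%:R^-1].
Proof.
move=> HD; suff H k : exists s, [/\ 0 <= s, null s & s <= D + k.+1%:R^-1].
  by have [s Hs] := choice H; exists s.
have : (D%:E < (D + k.+1%:R^-1)%:E)%E by rewrite lte_fin ltrDl invr_gt0.
rewrite -HD => /ereal_inf_lt[_ [s [s0 ns] <-]].
by rewrite lte_fin => /ltW sD; exists s.
Qed.

Lemma large_index (D e : R) (c N : nat) : 0 < e ->
  exists k, [/\ (N <= k)%N, 3 * (D + 1) + 1 + c%:R <= k%:R & 5 / k.+1%:R <= e].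
Proof.
move=> e0; exists (maxn N (maxn (Num.truncn (3 * (D + 1) + 1 + c%:R)).+1
  (Num.truncn (5 / e)).+1)).
set k1 := (Num.truncn _).+1; set k2 := (Num.truncn (5 / e)).+1.
split; first exact: leq_maxl.
- apply: le_trans (ltW (truncnS_gt _)) _.
  by rewrite ler_nat -/k1; lia.
- rewrite ler_pdivrMr // mulrC -ler_pdivrMr //; apply: le_trans (ltW (truncnS_gt _)) _.
  by rewrite ler_nat -/k2; lia.
Qed.

(** The [k]-th cover is fine enough for its sets to serve levels above [k * k.+1], where naming with
    [m = k] costs little. Each point lies in a set of every cover, so each large [k] gives one cheap
    level, which is enough for a lower limit. *)
Lemma hausdorff_dim_attained V (hV : optimal R n V) E (D : R) : 0 <= D ->
  hausdorff_dim E = D%:E ->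
  exists A, forall x, E x -> (lower_complexity_density V A x <= D%:E)%E.
Proof.
move=> D0 /minimizing_exponents[s Hs].
have cover k : exists IU : set nat * (nat -> set 'rV[R]_n),
    is_cover (2 ^- (k * k.+1 + 3)) E IU.1 IU.2 /\
    (\esum_(i in IU.1) poweR (diam (IU.2 i)) (s k) <= 1)%E.
  have [_ null _] := Hs k; pose d : R := 2 ^- (k * k.+1 + 3).
  have d0 : 0 < d by rewrite invr_gt0 exprn_gt0.
  have /ereal_inf_lt[_ [I [U [cov ->]]] /ltW sum1] : (hausdorff_content (s k) d E < 1)%E.
    apply: (@le_lt_trans _ _ 0%E); last by rewrite lte_fin.
    by rewrite -null hausdorff_measureE; apply: ereal_sup_ubound; exists d.
  by exists (I, U).
have {cover} [IU HIU] := choice cover.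
pose l m r := (Num.truncn (s m * (r + 3)%:R)).+1.
have level (mr : nat * nat) : exists L : seq 'rV[rat]_n,
    (size L <= 2 ^ l mr.1 mr.2)%N /\
    forall i x, (IU mr.1).1 i -> (IU mr.1).2 i x ->
      ((2 ^- (mr.2 + 2))%:E <= diam ((IU mr.1).2 i) < (2 * 2 ^- (mr.2 + 2))%:E)%E ->
      exists2 q, q \in L & enorm (x - map_mx ratr q) < 2 ^- mr.2.
  have [s0 _ _] := Hs mr.1; have [_ sum1] := HIU mr.1.
  by have [L sL HL] := cover_level_points mr.2 s0 sum1; exists L.
have {level} [L HL] := choice level.
have [A [c Hc]] := optimal_coding_seq hV (fun m r => (HL (m, r)).1).
exists A => x Ex; apply/lee_addgt0Pr => e e0.
apply: limn_einf_le_io => N.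
have [k [Nk ck ke]] := large_index D c N.+1 e0.
have [s0 _ sD] := Hs k; have [[Ecov Udiam] _] := HIU k.
have [i Ii Uix] := Ecov x Ex; have /andP[d0 d1] := Udiam i Ii.
have fd : diam ((IU k).2 i) \is a fin_num.
  by rewrite ge0_fin_numE ?(le_lt_trans d1) ?ltry // ltW.
have [|r' kr' dr'] := @dyadic_scale R (fine (diam ((IU k).2 i))) (k * k.+1 + 3).
  by rewrite -lte_fin -lee_fin !fineK // d0.
(* A set of dyadic size [r + 2] is approximated at precision [r]; the [3] in the mesh leaves
   [k * k.+1 < r] after this shift. *)
have [r rE] : exists r, r' = (r + 2)%N by exists (r' - 2)%N; lia.
have kr : (k * k.+1 < r)%N by lia.
have Nr : (N < r)%N by apply: leq_trans Nk _; nia.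
have [q qL xq] : exists2 q, q \in L (k, r) & enorm (x - map_mx ratr q) < 2 ^- r.
  apply: ((HL (k, r)).2 i x Ii Uix) => /=.
  by rewrite -(fineK fd) lee_fin lte_fin -rE.
exists r; first exact: ltnW.
apply: (point_complexity_le _ (Hc k r q qL) xq); first exact: leq_ltn_trans Nr.
apply: le_trans (program_length_le D0 s0 sD ck (leqnn k) (ltnW kr)) _.
by rewrite ler_wpM2r // lerD2l.
Qed.

(** An upper limit concerns all large [r], so [m] is fixed for given [x] and [e]: it encodes the
    exponent index [k] and a piece containing [x], and the length estimate holds for all [r] past a
    bound. *)
Lemma packing_dim_attained V (hV : optimal R n V) E (D : R) : 0 <= D ->
  packing_dim E = D%:E ->
  exists A, forall x, E x -> (upper_complexity_density V A x <= D%:E)%E.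
Proof.
move=> D0 /minimizing_exponents[s Hs].
have pieces k : exists F : nat -> set 'rV[R]_n, E `<=` \bigcup_j F j /\
    forall j, exists2 d, 0 < d & (packing_content (s k) d (F j) <= 1)%E.
  have [_ null _] := Hs k.
  have /ereal_inf_lt[_ [F EF <-] sum1] : (packing_measure (s k) E < 1)%E.
    by rewrite null lte_fin.
  exists F; split=> // j.
  have : (packing_premeasure (s k) (F j) < 1)%E.
    apply: le_lt_trans sum1; apply: le_trans (nneseries_lim_ge j.+1 _); last first.
      by move=> i _ _; exact: packing_premeasure_ge0.
    rewrite big_nat_recr //= leeDr // sume_ge0 // => i _.
    exact: packing_premeasure_ge0.
  by rewrite packing_premeasureE => /ereal_inf_lt[_ [d d0 <-] /ltW]; exists d.
have {pieces} [F HF] := choice pieces.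
have dpos (kj : nat * nat) : exists d, 0 < d /\
    (packing_content (s kj.1) d (F kj.1 kj.2) <= 1)%E.
  by have [_ /(_ kj.2)[d d0 d1]] := HF kj.1; exists d.
have {dpos} [d Hd] := choice dpos.
pose dec m := (nth 0%N (CodeSeq.decode m) 0, nth 0%N (CodeSeq.decode m) 1).
pose l m r := (Num.truncn (s (dec m).1 * (r + 3)%:R)).+1.
have level (mr : nat * nat) : exists L : seq 'rV[rat]_n,
    (size L <= 2 ^ l mr.1 mr.2)%N /\
    (2 ^- (mr.2 + 3) <= d (dec mr.1) -> forall x, F (dec mr.1).1 (dec mr.1).2 x ->
      exists2 q, q \in L & enorm (x - map_mx ratr q) < 2 ^- mr.2).
  have [s0 _ _] := Hs (dec mr.1).1; have [_ cont1] := Hd (dec mr.1).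
  (* At scales too coarse for the piece, finitely many for each, the list is empty. *)
  have [dr|dr] := leP (2 ^- (mr.2 + 3)) (d (dec mr.1)); last by exists [::].
  by have [L sL HL] := packing_level_points s0 cont1 dr; exists L.
have {level} [L HL] := choice level.
have [A [c Hc]] := optimal_coding_seq hV (fun m r => (HL (m, r)).1).
exists A => x Ex; apply/lee_addgt0Pr => e e0.
have [k [_ ck ke]] := large_index D c 0 e0.
have [EF _] := HF k; have [j _ Fjx] := EF x Ex.
have [s0 _ sD] := Hs k.
(* [CodeSeq.code] is used as a pairing function because [k <= m], so that the
   [r %/ m.+1] bits of overhead are at most [r / (k + 1)]. *)
pose m := CodeSeq.code [:: k; j].
have decm : dec m = (k, j) by rewrite /dec /m CodeSeq.codeK.
have km : (k <= m)%N by have /= /and3P[/ltnW] := CodeSeq.ltn_code [:: k; j].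
have [M HM] := exp2_le_eventually (Hd (k, j)).1.
apply: (@limn_esup_le_near _ _ _ (maxn (m * m.+1).+1 M)) => r.
rewrite geq_max => /andP[mr Mr].
have [q qL xq] : exists2 q, q \in L (m, r) & enorm (x - map_mx ratr q) < 2 ^- r.
  apply: ((HL (m, r)).2 _ x); rewrite -[(m, r).1]/m decm //=.
  apply: le_trans (HM (r + 3)%N (leq_trans Mr (leq_addr _ _))).
  by rewrite ler_peMl ?invr_ge0 ?exprn_ge0 // ler1n.
apply: (point_complexity_le _ (Hc m r q qL) xq); first exact: leq_ltn_trans mr.
rewrite /l decm.
apply: le_trans (program_length_le D0 s0 sD ck km (ltnW mr)) _.
by rewrite ler_wpM2r // lerD2l.
Qed.

(** * Nonnegativity of the densities and the minimum over oracles *)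

Lemma limn_einf_ge0 (u : (\bar R)^nat) : (forall r, 0 <= u r)%E -> (0 <= limn_einf u)%E.
Proof.
move=> u0; rewrite limn_einf_lim (cvg_lim _ (@cvg_einfs_sup _ u)) //.
apply: (@le_trans _ _ (einfs u 0)); last by apply: ereal_sup_ubound; exists 0%N.
by apply: le_ereal_inf_tmp => _ [r _ <-].
Qed.

Lemma complexity_ratio_ge0 V (A : set nat) (x : 'rV[R]_n) r :
  (0 <= point_complexity V A r x / r%:R%:E)%E.
Proof.
apply: mule_ge0; last by rewrite inve_ge0 lee_fin.
apply: le_ereal_inf_tmp => _ [q _ <-]; apply: le_ereal_inf_tmp => _ [p _ <-].
by rewrite lee_fin.
Qed.

Lemma lower_complexity_density_ge0 V (A : set nat) (x : 'rV[R]_n) :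
  (0 <= lower_complexity_density V A x)%E.
Proof. by apply: limn_einf_ge0 => r; exact: complexity_ratio_ge0. Qed.

Lemma upper_complexity_density_ge0 V (A : set nat) (x : 'rV[R]_n) :
  (0 <= upper_complexity_density V A x)%E.
Proof. exact: le_trans (lower_complexity_density_ge0 V A x) (limn_einf_sup _). Qed.

End Upper.

Lemma is_minimum_dimension (R : realType) (T : Type) (E : set T)
    (dens : set nat -> T -> \bar R) (null : R -> Prop) :
  let dim := ereal_inf [set s%:E | s in [set s : R | 0 <= s /\ null s]] in
  E !=set0 -> (forall A x, 0 <= dens A x)%E ->
  (forall A s s', 0 <= s -> s < s' -> (forall x, E x -> (dens A x < s%:E)%E) -> null s') ->
  (forall D, 0 <= D -> dim = D%:E -> exists A, forall x, E x -> (dens A x <= D%:E)%E) ->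
  is_minimum [set ereal_sup [set dens A x | x in E] | A in [set: set nat]] dim.
Proof.
move=> dim [x0 Ex0] dens0 lower upper.
have lb A : (dim <= ereal_sup [set dens A x | x in E])%E.
  set S := ereal_sup _.
  have densS x : E x -> (dens A x <= S)%E.
    by move=> Ex; apply: ereal_sup_ubound; exists x.
  (* Nonemptiness of [E] excludes the value [-oo] of the supremum. *)
  have S0 : (0 <= S)%E by apply: le_trans (densS _ Ex0).
  case: S S0 densS => [a|_ _|//]; last exact: leey.
  rewrite lee_fin => a0 densS; apply/lee_addgt0Pr => e e0.
  apply: ereal_inf_lbound; exists (a + e) => //; split; first by rewrite addr_ge0 // ltW.
  (* The midpoint [a + e / 2] is strictly above all densities and strictly below [a + e]. *)
  apply: (lower A (a + e / 2)); [lra|lra|].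
  by move=> x /densS /le_lt_trans; apply; rewrite lte_fin; lra.
split; last by move=> _ [A _ <-].
have dim0 : (0 <= dim)%E by apply: le_ereal_inf_tmp => _ [s [s0 _] <-]; rewrite lee_fin.
case E1 : dim dim0 => [D| |] //.
  rewrite lee_fin => D0; have [A HA] := upper D D0 E1; exists A => //.
  apply/eqP; rewrite eq_le -{2}E1 lb andbT.
  by apply: ge_ereal_sup => _ [x Ex <-]; exact: HA.
(* In the case [dim = +oo] the lower bound makes every supremum infinite, so any oracle attains
   it. *)
move=> _; exists setT => //; apply/eqP; rewrite eq_le leey /=.
by rewrite -E1 lb.
Qed.

Theorem corollary5p9 (R : realType) (n : nat) (hn : (1 <= n)%N)
    (V : oracle_machine) (hV : optimal R n V)
    (E : set 'rV[R]_n) (hE : E !=set0) :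
  is_minimum
    [set ereal_sup [set lower_complexity_density V A x | x in E] | A in [set: set nat]]
    (hausdorff_dim E) /\
  is_minimum
    [set ereal_sup [set upper_complexity_density V A x | x in E] | A in [set: set nat]]
    (packing_dim E).
Proof.
split; apply: is_minimum_dimension hE _ _ _.
- by move=> A x; exact: lower_complexity_density_ge0.
- by move=> A s s' s0 ss'; exact: lower_complexity_density_null.
- by move=> D; exact: hausdorff_dim_attained.
- by move=> A x; exact: upper_complexity_density_ge0.
- by move=> A s s' s0 ss'; exact: upper_complexity_density_null.
- by move=> D; exact: packing_dim_attained.
Qed.
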